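(* The following hold: (i) $\overline D\subset\mathcal{E}_p\cap\Omega$; (ii) $\mathcal{E}_p\cap\Omega\subset\mathcal{R}_p$ and $2d_{\mathcal{E}_p\cap\Omega}(p)\ge l(p,D)+d_{\partial\Omega}(p)$.
   Context: Setting. $\Omega\subset\mathbb{R}^3$ is a bounded domain with $C^{2,\alpha_0}$ boundary, $0<\alpha_0\le1$; $D$ is an open subset of $\Omega$ with $C^{2,\alpha_0}$ boundary such that $\overline D\subset\Omega$ and $\Omega\setminus\overline D$ is connected; $p\in\mathbb{R}^3\setminus\overline\Omega$. $l(p,D)=\inf_{(x,y)\in\partial D\times\partial\Omega}(|p-x|+|x-y|)$. For $y\in\partial\Omega$, $\mathcal{E}_p(y)=\{x\in\mathbb{R}^3:|p-x|+|x-y|\ge l(p,D)\}$, and $\mathcal{E}_p=\bigcap_{y\in\partial\Omega}\mathcal{E}_p(y)$. Further, $d_{\partial\Omega}(p)=\inf\{|y-p|:y\in\partial\Omega\}$, $\mathcal{R}_p=\{x\in\mathbb{R}^3:|p-x|\ge2^{-1}(d_{\partial\Omega}(p)+l(p,D))\}$, and $d_{\mathcal{E}_p\cap\Omega}(p)=\inf\{|x-p|:x\in\mathcal{E}_p\cap\Omega\}$. *)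

(* Defs.v *)
From HB Require Import structures.
From mathcomp Require Import all_boot all_order all_algebra.
From mathcomp Require Import all_classical all_reals all_analysis.

Set Implicit Arguments.
Unset Strict Implicit.
Unset Printing Implicit Defensive.
Import Order.TTheory GRing.Theory Num.Theory.
Import numFieldNormedType.Exports.

Local Open Scope classical_set_scope.
Local Open Scope ring_scope.

(* The library norm on 'rV[R]_n is the sup norm; it is used here only through
   the topology, the bounded sets and the derivatives it induces, which agree
   with the Euclidean ones.  All distances are measured with [enorm]. *)
Definition enorm (R : realType) (n : nat) (x : 'rV[R]_n) : R :=
  Num.sqrt (\sum_(i < n) x ord0 i ^+ 2).

Definition boundary (T : topologicalType) (A : set T) : set T :=
  closure A `\` interior A.

Definition domain (R : realType) (n : nat) (A : set 'rV[R]_n) : Prop :=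
  [/\ A !=set0, open A & connected A].

Definition partial (R : realType) (n : nat) (i : 'I_n) (g : 'rV[R]_n -> R) :
    'rV[R]_n -> R :=
  'D_(delta_mx ord0 i) g.

Definition partially_derivable_on (R : realType) (n : nat) (U : set 'rV[R]_n)
    (g : 'rV[R]_n -> R) : Prop :=
  forall (i : 'I_n) z, U z -> derivable g z (delta_mx ord0 i).

Definition C2_on (R : realType) (n : nat) (U : set 'rV[R]_n)
    (g : 'rV[R]_n -> R) : Prop :=
  [/\ {in U, continuous g},
      partially_derivable_on U g,
      forall i, {in U, continuous (partial i g)},
      forall i, partially_derivable_on U (partial i g) &
      forall i j, {in U, continuous (partial j (partial i g))}].

Definition holder_on (R : realType) (n : nat) (a : R) (U : set 'rV[R]_n)
    (g : 'rV[R]_n -> R) : Prop :=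
  exists C : R, forall z w, U z -> U w ->
    `|g z - g w| <= C * enorm (z - w) `^ a.

Definition C2holder_on (R : realType) (n : nat) (a : R) (U : set 'rV[R]_n)
    (g : 'rV[R]_n -> R) : Prop :=
  C2_on U g /\ forall i j, holder_on a U (partial j (partial i g)).

(* The open set A has C^{2,a} boundary: near each x0 of its boundary, in
   Cartesian coordinates centred at x0 (the orthogonal matrix Q is the change
   of axes), A is the region strictly above the graph of a C^{2,a} function of
   the first two coordinates.  [col' ord_max] drops the third coordinate. *)
Definition C2holder_boundary (R : realType) (a : R) (A : set 'rV[R]_3) : Prop :=
  forall x0, boundary A x0 ->
  exists r : R, exists Q : 'M[R]_3, exists g : 'rV[R]_2 -> R,
  [/\ 0 < r,
      Q *m Q^T = 1%:M,
      C2holder_on a [set z | enorm z < r] g &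
      forall x, enorm (x - x0) < r ->
        let y := (x - x0) *m Q in
        A x <-> g (col' ord_max y) < y ord0 ord_max].

(* Infima are taken in \bar R, so that the infimum over an empty set is +oo. *)

Definition dist_to (R : realType) (n : nat) (A : set 'rV[R]_n) (p : 'rV[R]_n) :
    \bar R :=
  ereal_inf [set (enorm (y - p))%:E | y in A].

Definition broken_path (R : realType) (n : nat) (p x y : 'rV[R]_n) : R :=
  enorm (p - x) + enorm (x - y).

Definition shortest_path (R : realType) (n : nat) (Omega D : set 'rV[R]_n)
    (p : 'rV[R]_n) : \bar R :=
  ereal_inf [set (broken_path p x y)%:E | x in boundary D & y in boundary Omega].

Definition E_set_at (R : realType) (n : nat) (Omega D : set 'rV[R]_n)
    (p y : 'rV[R]_n) : set 'rV[R]_n :=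
  [set x | (shortest_path Omega D p <= (broken_path p x y)%:E)%E].

Definition E_set (R : realType) (n : nat) (Omega D : set 'rV[R]_n)
    (p : 'rV[R]_n) : set 'rV[R]_n :=
  \bigcap_(y in boundary Omega) E_set_at Omega D p y.

Definition R_set (R : realType) (n : nat) (Omega D : set 'rV[R]_n)
    (p : 'rV[R]_n) : set 'rV[R]_n :=
  [set x | ((2^-1)%:E * (dist_to (boundary Omega) p + shortest_path Omega D p)
            <= (enorm (p - x))%:E)%E].

(* Main.v *)
(* Both parts rest on one fact: if [p] is not in [closure A] and [x] is, the
   segment from [p] to [x] meets the boundary of [A] at a point [z] with
   |p-z| + |z-x| = |p-x|.  For (i) take A = D: replacing [x] by [z] does not
   lengthen the path p-x-y, by the triangle inequality.  For (ii) take
   A = Omega: with y = z, the path p-x-y has length 2|p-x| - |p-y|, and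
   |p-y| is at least the distance from [p] to the boundary of [Omega]. *)
Require Import Defs.
From HB Require Import structures.
From mathcomp Require Import all_boot all_order all_algebra.
From mathcomp Require Import all_classical all_reals all_analysis.
From mathcomp Require Import ring lra.

Import Order.TTheory GRing.Theory Num.Theory.
Import numFieldNormedType.Exports.

Local Open Scope classical_set_scope.
Local Open Scope ring_scope.

Lemma enorm_ge0 (R : realType) (n : nat) (x : 'rV[R]_n) : 0 <= enorm x.
Proof. exact: sqrtr_ge0. Qed.

Lemma sqr_enorm (R : realType) (n : nat) (x : 'rV[R]_n) :
  enorm x ^+ 2 = \sum_(i < n) x ord0 i ^+ 2.
Proof. by rewrite sqr_sqrtr // sumr_ge0 // => i _; exact: sqr_ge0. Qed.

Lemma enormZ (R : realType) (n : nat) (a : R) (x : 'rV[R]_n) :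
  enorm (a *: x) = `|a| * enorm x.
Proof.
rewrite /enorm -sqrtr_sqr -sqrtrM ?sqr_ge0 // mulr_sumr.
by congr Num.sqrt; apply: eq_bigr => i _; rewrite mxE exprMn.
Qed.

Lemma enormN (R : realType) (n : nat) (x : 'rV[R]_n) : enorm (- x) = enorm x.
Proof. by rewrite -scaleN1r enormZ normrN1 mul1r. Qed.

Lemma enorm_distC (R : realType) (n : nat) (x y : 'rV[R]_n) :
  enorm (x - y) = enorm (y - x).
Proof. by rewrite -opprB enormN. Qed.

Lemma enorm_eq0 (R : realType) (n : nat) (x : 'rV[R]_n) :
  enorm x = 0 -> x = 0.
Proof.
move=> x0; apply/rowP => i; rewrite mxE; apply/eqP; rewrite -sqrf_eq0.
have : \sum_(i < n) x ord0 i ^+ 2 == 0 by rewrite -sqr_enorm x0 expr0n.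
by rewrite psumr_eq0 => [/allP/(_ i (mem_index_enum i))|j _]; rewrite ?sqr_ge0.
Qed.

(** For nonzero vectors, expanding the nonnegative sum of the squares $(|y|x_i-|x|y_i)^2$ gives
    $2|x||y|(|x||y|-\langle x,y\rangle)\ge0$, and the positive factor $|x||y|$ cancels. *)
Lemma enorm_cauchy_schwarz (R : realType) (n : nat) (x y : 'rV[R]_n) :
  \sum_(i < n) x ord0 i * y ord0 i <= enorm x * enorm y.
Proof.
have [/enorm_eq0 ->|x0] := eqVneq (enorm x) 0.
  rewrite big1 ?mulr_ge0 ?enorm_ge0 // => i _.
  by rewrite mxE mul0r.
have [/enorm_eq0 ->|y0] := eqVneq (enorm y) 0.
  rewrite big1 ?mulr_ge0 ?enorm_ge0 // => i _.
  by rewrite mxE mulr0.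
have xy0 : 0 < enorm x * enorm y by rewrite mulr_gt0 // lt_def enorm_ge0 ?x0 ?y0.
have : 0 <= \sum_(i < n) (enorm y * x ord0 i - enorm x * y ord0 i) ^+ 2.
  by apply: sumr_ge0 => i _; exact: sqr_ge0.
have -> : \sum_(i < n) (enorm y * x ord0 i - enorm x * y ord0 i) ^+ 2 =
    enorm y ^+ 2 * (\sum_(i < n) x ord0 i ^+ 2)
    + enorm x ^+ 2 * (\sum_(i < n) y ord0 i ^+ 2)
    - 2 * (enorm x * enorm y) * \sum_(i < n) x ord0 i * y ord0 i.
  rewrite !mulr_sumr -big_split /= -sumrB; apply: eq_bigr => i _; ring.
by rewrite -!sqr_enorm => ?; nra.
Qed.

Lemma ler_enormD (R : realType) (n : nat) (x y : 'rV[R]_n) :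
  enorm (x + y) <= enorm x + enorm y.
Proof.
rewrite -(@ler_pXn2r _ 2) ?nnegrE ?addr_ge0 ?enorm_ge0 //.
have -> : enorm (x + y) ^+ 2 = enorm x ^+ 2 + enorm y ^+ 2
    + 2 * \sum_(i < n) x ord0 i * y ord0 i.
  rewrite !sqr_enorm mulr_sumr -!big_split /=.
  by apply: eq_bigr => i _; rewrite mxE; ring.
by have := enorm_cauchy_schwarz _ _ x y; nra.
Qed.

Lemma ler_enorm_distD (R : realType) (n : nat) (z x y : 'rV[R]_n) :
  enorm (x - y) <= enorm (x - z) + enorm (z - y).
Proof. by rewrite -[x - y](subrKA z) ler_enormD. Qed.

(** If [C] missed the boundary of [A], the trace of [closure A] on [C] would equal that of the
    interior. It would then be nonempty and both open and closed in [C], hence all of [C], which [p]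
    contradicts. *)
Lemma connected_meets_boundary (T : topologicalType) (C A : set T) (p x : T) :
  connected C -> C p -> C x -> ~ closure A p -> closure A x ->
  exists2 z, C z & boundary A z.
Proof.
move=> Cconn Cp Cx Ap Ax; apply: contrapT => /forall2NP Cbd.
have CA : C `&` closure A = C.
  apply: Cconn; first by exists x.
  - exists A°; first exact: open_interior.
    apply/seteqP; split=> z [Cz Az]; split=> //.
      by apply: contrapT => Aoz; case: (Cbd z) => //; apply; split.
    exact: (subset_closure (interior_subset Az)).
  - by exists (closure A) => //; exact: closed_closure.
by move: Cp; rewrite -CA => -[].
Qed.

(** The segment is the continuous image of $[0,1]$ under [f], hence connected, so it meets the
    boundary at some [f t]. This point cuts it into lengths $t|p-x|$ and $(1-t)|p-x|$. *)
Lemma boundary_between (R : realType) (n : nat) (A : set 'rV[R]_n)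
    (p x : 'rV[R]_n) :
  ~ closure A p -> closure A x ->
  exists2 z, boundary A z & enorm (p - z) + enorm (z - x) = enorm (p - x).
Proof.
move=> Ap Ax; pose f (t : R) := p + t *: (x - p).
have fcont : continuous f.
  by move=> t; apply: cvgD; [exact: cvg_cst|apply: cvgZl; exact: cvg_id].
have [||_ [t /andP[t0 t1] <-] zbd] := connected_meets_boundary _ _ _ _ _
    (connected_continuous_connected (@segment_connected R 0 1)
      (continuous_subspaceT fcont)) _ _ Ap Ax.
- by exists 0; rewrite /f ?scale0r ?addr0 //= in_itv /= lexx ler01.
- by exists 1; rewrite /f ?scale1r ?subrKC //= in_itv /= lexx ler01.
exists (f t) => //.
have -> : p - f t = t *: (p - x).
  by rewrite /f opprD addNKr -scalerN opprB.
have -> : f t - x = (1 - t) *: (p - x).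
  by rewrite /f scalerBl scale1r -(opprB p x) scalerN addrAC.
by rewrite !enormZ !ger0_norm ?subr_ge0 // -mulrDl subrKC mul1r.
Qed.

Theorem proposition6p4 (R : realType) (alpha0 : R) (Omega D : set 'rV[R]_3)
    (p : 'rV[R]_3)
    (halpha0 : 0 < alpha0 <= 1)
    (hOmega_domain : domain Omega)
    (hOmega_bounded : bounded_set Omega)
    (hOmega_boundary : C2holder_boundary alpha0 Omega)
    (hD_open : open D)
    (hD_boundary : C2holder_boundary alpha0 D)
    (hD_sub : closure D `<=` Omega)
    (hOmegaD_connected : connected (Omega `\` closure D))
    (hp : ~ closure Omega p) :
  closure D `<=` E_set Omega D p `&` Omega /\
  (E_set Omega D p `&` Omega `<=` R_set Omega D p /\
   (shortest_path Omega D p + dist_to (boundary Omega) p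
      <= 2%:E * dist_to (E_set Omega D p `&` Omega) p)%E).
Proof.
(* This inclusion comes first because the distance estimate at the end follows from it. *)
have ER : E_set Omega D p `&` Omega `<=` R_set Omega D p.
  move=> x [Ex Omx].
  have [y Omy pyx] := boundary_between _ _ _ _ _ hp (subset_closure Omx).
  rewrite /R_set /= lee_pdivrMl //.
  have dy : (dist_to (boundary Omega) p <= (enorm (p - y))%:E)%E.
    by rewrite enorm_distC; apply: ereal_inf_lbound; exists y.
  (* The two bounds add up to $|p-y|+|p-x|+|x-y|$, which is $2|p-x|$ since [y] lies on the
     segment. *)
  apply: le_trans (leeD dy (Ex y Omy)) _.
  rewrite -EFinD -EFinM lee_fin /broken_path (enorm_distC _ _ x y); lra.
split.
  move=> x Dx; split; last exact: hD_sub.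
  move=> y Omy.
  have pD : ~ closure D p by move=> /hD_sub /subset_closure.
  have [z Dz pzx] := boundary_between _ _ _ _ _ pD Dx.
  (* The path through [z] competes in the infimum $l(p,D)$, as [z] is in the boundary of [D]. *)
  apply: (@le_trans _ _ (broken_path p z y)%:E).
    by apply: ereal_inf_lbound; exists z => //; exists y.
  rewrite lee_fin /broken_path.
  by have := ler_enorm_distD _ _ x z y; lra.
split=> //.
(* Once halved, the claim says that the radius defining [R_set] is a lower bound for the distances
   from [p] to points of the set, which is [ER]. *)
rewrite -lee_pdivrMl // addeC; apply: le_ereal_inf_tmp => _ [x Ex <-].
by rewrite enorm_distC; exact: ER.
Qed.
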